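(* Let $p(x)$ be a partial type over a set $A$ such that for every $A'\supseteq A$ with $A'\setminus A$ finite, every $A'$-indiscernible sequence $\langle a_i\mid i<|T|^{+}+|A|^{+}\rangle$ of tuples realizing $p$, and every singleton $c$, there is $\alpha<|T|^{+}+|A|^{+}$ such that $\langle a_i\mid\alpha<i\rangle$ is indiscernible over $A'\cup\{c\}$. Then $p$ is dependent.
   Context: $T$ is a complete first-order theory with monster model $\mathfrak{C}$. For a cardinal $\kappa$, $\operatorname{rk-dp}(p)<\kappa$ means: for every $a\models p$ and every $\kappa$ sequences mutually indiscernible over $A$ (each indiscernible over $A$ together with the others), at least one is indiscernible over $A\cup\{a\}$. $p$ is dependent if $\operatorname{rk-dp}(p)<\kappa$ for some cardinal $\kappa$. *)

(* Defs.v *)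
From HB Require Import structures.
From mathcomp Require Import all_boot all_order.
From mathcomp Require Import all_classical wochoice.

Set Implicit Arguments.
Unset Strict Implicit.
Unset Printing Implicit Defensive.

Local Open Scope classical_set_scope.
Local Open Scope card_scope.

(* A cardinal is represented by any type of that cardinality. *)

Definition card_lt (X Y : Type) : Prop :=
  [set: X] #<= [set: Y] /\ ~ ([set: Y] #<= [set: X]).

Definition is_succ_card (K X : Type) : Prop :=
  card_lt X K /\ forall Y : Type, card_lt X Y -> [set: K] #<= [set: Y].

Definition is_limit_card (K : Type) : Prop :=
  forall X : Type, card_lt X K -> exists2 Y : Type, card_lt X Y & card_lt Y K.

(* [I] is well-ordered in the order type of a cardinal, viewed as an initial
   ordinal. *)
Definition is_initial_ordinal (d : Order.disp_t) (I : orderType d) : Prop :=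
  well_order (<=%O : rel I) /\
  forall i : I, ~ ([set: I] #<= [set j : I | (j < i)%O]).

Record language : Type := Language {
  fsym : Type;
  farity : fsym -> nat;
  rsym : Type;
  rarity : rsym -> nat
}.

Inductive term (L : language) (V : Type) : Type :=
| Var of V
| App (f : fsym L) of ('I_(farity f) -> term L V).

(* Formulas with free variables in [V]; in [All f] the variable [None] of [f] is
   the one being bound. *)
Inductive formula (L : language) (V : Type) : Type :=
| Bot
| Eq of term L V & term L V
| Rel (r : rsym L) of ('I_(rarity r) -> term L V)
| Imp of formula L V & formula L V
| All of formula L (option V).

Arguments Bot {L V}.

Definition Neg (L : language) (V : Type) (f : formula L V) : formula L V :=
  Imp f Bot.

Definition sentence (L : language) : Type := formula L void.

Record structure (L : language) : Type := Structure {
  carrier :> Type;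
  carrier_inhabited : inhabited carrier;
  finterp : forall f : fsym L, ('I_(farity f) -> carrier) -> carrier;
  rinterp : forall r : rsym L, ('I_(rarity r) -> carrier) -> Prop
}.

Arguments finterp {L} s f _.
Arguments rinterp {L} s r _.

Section Semantics.
Variables (L : language) (M : structure L).

Fixpoint eval (V : Type) (e : V -> M) (t : term L V) : M :=
  match t with
  | Var v => e v
  | App f ts => finterp M f (fun i => eval e (ts i))
  end.

Fixpoint sat (V : Type) (e : V -> M) (f : formula L V) {struct f} : Prop :=
  match f with
  | Bot => False
  | Eq t u => eval e t = eval e u
  | Rel r ts => rinterp M r (fun i => eval e (ts i))
  | Imp g h => sat e g -> sat e h
  | All g => forall x : M, sat (fun v => oapp e x v) g
  end.

Definition models (T : set (sentence L)) : Prop :=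
  forall f, T f -> sat (of_void M) f.

(* Formulas over [A] in variables [V] are formulas in the variables [V + A],
   each element of [A] being a parameter that stands for itself. *)
Definition env (V : Type) (A : set M) (e : V -> M) (v : V + A) : M :=
  match v with
  | inl x => e x
  | inr a => val a
  end.

Definition same_type (V : Type) (A : set M) (e e' : V -> M) : Prop :=
  forall f : formula L (V + A), sat (env e) f <-> sat (env e') f.

Definition realizes (V : Type) (A : set M) (p : set (formula L (V + A)))
    (e : V -> M) : Prop :=
  forall f, p f -> sat (env e) f.

Definition is_partial_type (V : Type) (A : set M)
    (p : set (formula L (V + A))) : Prop :=
  forall q, q `<=` p -> finite_set q -> exists e : V -> M, realizes q e.

Definition is_automorphism (s : M -> M) : Prop :=
  [/\ bijective s,
      forall f (x : 'I_(farity f) -> M),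
        s (finterp M f x) = finterp M f (fun i => s (x i))
    & forall r (x : 'I_(rarity r) -> M),
        rinterp M r x <-> rinterp M r (fun i => s (x i))].

Definition is_saturated (K : Type) : Prop :=
  forall B : set M, card_lt B K ->
  forall q : set (formula L (unit + B)), is_partial_type q ->
  exists e : unit -> M, realizes q e.

Definition is_strongly_homogeneous (K : Type) : Prop :=
  forall V : Type, card_lt V K ->
  forall e e' : V -> M, same_type set0 e e' ->
  exists2 s : M -> M, is_automorphism s & forall v, s (e v) = e' v.

(* The sequence [a] of [J]-tuples, restricted to the indices in [D], is
   indiscernible over [B]. *)
Definition indiscernible (d : Order.disp_t) (I : orderType d) (J : Type)
    (D : set I) (B : set M) (a : I -> J -> M) : Prop :=
  forall (n : nat) (s t : 'I_n -> I),
    (forall k, D (s k)) -> (forall k, D (t k)) ->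
    {homo s : k l / (k < l)%N >-> (k < l)%O} ->
    {homo t : k l / (k < l)%N >-> (k < l)%O} ->
  same_type B (fun v : 'I_n * J => a (s v.1) v.2)
              (fun v : 'I_n * J => a (t v.1) v.2).

Definition mutually_indiscernible (d : Order.disp_t) (K : Type)
    (I : K -> orderType d) (J : K -> Type) (B : set M)
    (a : forall k, I k -> J k -> M) : Prop :=
  forall k,
    indiscernible setT
      (B `|` \bigcup_(l in [set l | l <> k]) \bigcup_i range (a l i)) (a k).

(* [rk_dp_lt S K p] is rk-dp(p) < |K|.  As usual in a monster model, sequences
   and their tuples are small, i.e. of cardinality < |S|. *)
Definition rk_dp_lt (S K V : Type) (A : set M) (p : set (formula L (V + A))) :
    Prop :=
  forall c : V -> M, realizes p c ->
  forall (d : Order.disp_t) (I : K -> orderType d) (J : K -> Type)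
         (a : forall k, I k -> J k -> M),
    (forall k, infinite_set [set: I k] /\ card_lt (I k) S) ->
    (forall k, card_lt (J k) S) ->
    mutually_indiscernible A a ->
  exists k, indiscernible setT (A `|` range c) (a k).

(* The bound |K| must be small: no more than |M| non-constant sequences can be
   mutually indiscernible, so with |K| unrestricted every type would qualify. *)
Definition dependent (S V : Type) (A : set M) (p : set (formula L (V + A))) :
    Prop :=
  exists2 K : Type, card_lt K S & rk_dp_lt S K p.

End Semantics.

Definition entails (L : language) (T : set (sentence L)) (f : sentence L) :
    Prop :=
  forall M : structure L, models M T -> sat (of_void M) f.

Definition is_complete (L : language) (T : set (sentence L)) : Prop :=
  (exists M : structure L, models M T) /\
  forall f, entails T f \/ entails T (Neg f).

(* |T| is the number of formulas, |L| + aleph_0. *)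
Definition card_theory (L : language) : Type := formula L nat.

(* [S] is the saturation cardinal of [C]; "small" means of cardinality < |S|. *)
Definition is_monster_model (L : language) (T : set (sentence L)) (S : Type)
    (C : structure L) : Prop :=
  [/\ models C T, is_limit_card S, card_lt (card_theory L) S,
      is_saturated C S & is_strongly_homogeneous C S].

(* Main.v *)
(** Suppose the dp-rank of [p] is not below a small cardinal [K] exceeding
    [|T| + |A| + |X|].  A realisation [c] of [p] then destroys the
    indiscernibility of each of [K] mutually indiscernible sequences, and by
    pigeonhole infinitely many of them are destroyed by one formula
    [phi(y, c)], true at a tuple [y_l^1] and false at a tuple [y_l^0].  Mutual
    indiscernibility lets one swap [y_l^0] and [y_l^1] independently for each
    [l], so by homogeneity every subset of the [y_l^1] is cut out by
    [phi(y, c')] for some realisation [c'] of [p].  Exchanging the roles of the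
    two sides of [phi], an infinite sequence of realisations of [p] is shattered
    by instances of [phi].  Ramsey and compactness turn it into an
    [A]-indiscernible sequence indexed by [W] along which some [phi(d, -)]
    changes its truth value cofinally.  Only finitely many coordinates of [d]
    matter; adding them to the parameters one by one, the hypothesis yields a
    tail indiscernible over [A] and these coordinates, a contradiction. *)

Require Import Defs.
From HB Require Import structures.
From mathcomp Require Import all_boot all_order.
From mathcomp Require Import all_classical.

Set Implicit Arguments.
Unset Strict Implicit.
Unset Printing Implicit Defensive.

Import Order.TTheory.

Local Open Scope classical_set_scope.
Local Open Scope card_scope.

(** * Cardinal arithmetic *)

(** Total injections between types replace [#<=] on full sets, whose witnesses act on subtypes;
    [card_leTP] converts. *)
Definition embeds (X Y : Type) : Prop := exists f : X -> Y, injective f.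

Lemma card_leTP (X Y : Type) : [set: X] #<= [set: Y] <-> embeds X Y.
Proof.
split=> [/card_leP[f]|[f f_inj]]; last first.
  have /inj_card_eq : {in [set: X] &, injective f} by move=> x y _ _; apply: f_inj.
  rewrite card_eq_le => /andP[_ /card_le_trans]; apply; exact: card_leT.
pose i x : [set: X] := exist _ x (mem_set Logic.I).
exists (fun x => val (f (i x))) => x y /val_inj /inj.
by rewrite !inE => /(_ Logic.I Logic.I)/(congr1 val).
Qed.

Lemma embeds_refl (X : Type) : embeds X X.
Proof. by exists id. Qed.

Lemma embeds_trans (X Y Z : Type) : embeds X Y -> embeds Y Z -> embeds X Z.
Proof. by move=> [f fi] [g gi]; exists (g \o f); exact: inj_comp. Qed.

(** Zorn's lemma on graphs of partial injections: a maximal graph is total on one side, since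
    otherwise it could take in a pair of points missing from both sides. *)
Lemma embeds_total (X Y : Type) : embeds X Y \/ embeds Y X.
Proof.
pose P (G : set (X * Y)) :=
  (forall x y y', G (x, y) -> G (x, y') -> y = y') /\
  (forall x x' y, G (x, y) -> G (x', y) -> x = x').
have [F FP Ftot|G [[Gf Gi] Gmax]] := @Zorn_bigcup (X * Y)%type P.
  split=> [x y y' [G FG Gxy] [G' FG' Gxy']|x x' y [G FG Gxy] [G' FG' Gxy']].
    have [Gf _] := FP _ FG; have [G'f _] := FP _ FG'.
    by have [/(_ _ Gxy)|/(_ _ Gxy')] := Ftot _ _ FG FG' => H; eauto.
  have [_ Gi] := FP _ FG; have [_ G'i] := FP _ FG'.
  by have [/(_ _ Gxy)|/(_ _ Gxy')] := Ftot _ _ FG FG' => H; eauto.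
have [/choice[f Gxf]|nX] := pselect (forall x, exists y, G (x, y)).
  by left; exists f => x x' e; apply: Gi (Gxf x) _; rewrite e.
have [/choice[g Ggy]|nY] := pselect (forall y, exists x, G (x, y)).
  by right; exists g => y y' e; apply: Gf (Ggy y) _; rewrite e.
move/existsNP: nX => [x nx]; move/existsNP: nY => [y ny].
pose G' := G `|` [set (x, y)].
have PG' : P G'.
  split=> [u v v'|u u' v] [Guv|[-> ->]] [Guv'|].
  - exact: Gf Guv Guv'.
  - by move=> [eu _]; case: nx; exists v; rewrite -eu.
  - by case: nx; exists v'.
  - by case.
  - exact: Gi Guv Guv'.
  - by move=> [_ ev]; case: ny; exists u; rewrite -ev.
  - by case: ny; exists u'.
  - by case.
exfalso; apply: (Gmax G' _ PG'); split; first by move=> z Gz; left.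
by move=> /(_ (x, y)) H; case: nx; exists y; apply: H; right.
Qed.

(** Hessenberg's theorem. Zorn's lemma is applied to sets [D] containing the range of [i], each with
    an injection of [D * D] into [D]. For a maximal [D], either the complement embeds in [D], and
    then so does [X], or a copy of [D] inside the complement allows a proper extension. *)
Lemma embeds_mul_self (X : Type) : embeds nat X -> embeds (X * X) X.
Proof.
move=> [i i_inj].
pose ok (t : set X * (X -> X -> X)) :=
  [/\ forall n, t.1 (i n),
      forall x y, t.1 x -> t.1 y -> t.1 (t.2 x y)
    & forall x y x' y', t.1 x -> t.1 y -> t.1 x' -> t.1 y' ->
        t.2 x y = t.2 x' y' -> x = x' /\ y = y'].
(* [j] inverts [i], so the coding of pairs of naturals by [pickle] makes the range of [i] a first
   [D]. *)
pose j x : nat := xget 0%N [set n | i n = x].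
have jK n : j (i n) = n by apply: i_inj; rewrite /j; case: xgetP => // /(_ n)[].
have ok0 : ok (range i, fun x y => i (pickle (j x, j y))).
  split=> [n|_ _ [n _ <-] [m _ <-]|_ _ _ _ [n _ <-] [m _ <-] [n' _ <-] [m' _ <-]] /=.
  - by exists n.
  - by exists (pickle (j (i n), j (i m))).
  - by rewrite !jK => /i_inj/(pcan_inj pickleK)[-> ->].
pose R (t u : {t | ok t}) :=
  `[< (sval t).1 `<=` (sval u).1 /\
      forall x y, (sval t).1 x -> (sval t).1 y ->
        (sval u).2 x y = (sval t).2 x y >].
have [|r s t /asboolP[rs frs] /asboolP[st fst']|F Ftot|] :=
  @ZL_preorder _ (exist _ _ ok0) R.
- by move=> t; apply/asboolP; split.
- apply/asboolP; split=> [x /rs/st //|x y rx ry].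
  by rewrite fst' ?frs //; apply: rs.
- have [[t0 Ft0]|nF] := pselect (exists t, F t); last first.
    by exists (exist _ _ ok0) => s Fs; case: nF; exists s.
  pose D := [set x | exists2 t, F t & (sval t).1 x].
  pose Q x y z := exists t, [/\ F t, (sval t).1 x, (sval t).1 y
                              & z = (sval t).2 x y].
  have /choice[f fP] xy : exists z, D xy.1 -> D xy.2 -> Q xy.1 xy.2 z.
    case: xy => x y /=.
    have [[t Ft tx]|nx] := pselect (D x); last by exists (i 0%N).
    have [[u Fu uy]|ny] := pselect (D y); last by exists (i 0%N).
    have [/asboolP[tu _]|/asboolP[ut _]] := Ftot _ _ Ft Fu.
      by exists ((sval u).2 x y) => _ _; exists u; split=> //; apply: tu.
    by exists ((sval t).2 x y) => _ _; exists t; split=> //; apply: ut.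
  have fE t x y : F t -> (sval t).1 x -> (sval t).1 y ->
      f (x, y) = (sval t).2 x y.
    move=> Ft tx ty; have [||u [Fu ux uy ->]] := fP (x, y).
    - by exists t.
    - by exists t.
    by have [/asboolP[_ ->]|/asboolP[_ ->]] := Ftot _ _ Ft Fu.
  have D2 x y : D x -> D y ->
      exists t, [/\ F t, (sval t).1 x & (sval t).1 y].
    move=> Dx Dy; have [t [Ft tx ty _]] := fP (x, y) Dx Dy.
    by exists t.
  have okf : ok (D, fun x y => f (x, y)).
    split=> [n|x y Dx Dy|x y x' y' Dx Dy Dx' Dy'] /=.
    - by exists t0 => //; have [+ _ _] := svalP t0; apply.
    - have [t [Ft tx ty]] := D2 _ _ Dx Dy; rewrite (fE t) //.
      by exists t => //; have [_ + _] := svalP t; apply.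
    - have [t [Ft tx ty]] := D2 _ _ Dx Dy.
      have [u [Fu ux uy]] := D2 _ _ Dx' Dy'.
      have [/asboolP[tu _]|/asboolP[ut _]] := Ftot _ _ Ft Fu.
        rewrite !(fE u) //; try exact: tu.
        by have [_ _ ] := svalP u; apply=> //; apply: tu.
      rewrite !(fE t) //; try exact: ut.
      by have [_ _ ] := svalP t; apply=> //; apply: ut.
  exists (exist _ _ okf) => t Ft; apply/asboolP; split=> [x tx|x y tx ty] /=.
    by exists t.
  exact: fE.
move=> [[D f] Dok] Dmax; have [/= Di Df finj] := Dok.
have [[g g_inj]|[g g_inj]] := embeds_total {x | ~ D x} {x | D x}.
  (* The labels [i 0] and [i 1] keep [D] and its complement apart, so [u] injects all of [X] into
     [D]. *)
  pose u x : X := match pselect (D x) with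
    | left _ => f x (i 0%N)
    | right nx => f (sval (g (exist _ x nx))) (i 1%N)
    end.
  have Du x : D (u x).
    rewrite /u; case: pselect => [Dx|nx]; apply: Df => //.
    exact: svalP.
  have u_inj : injective u.
    move=> x y; rewrite /u.
    have Dg z : D (sval (g z)) by exact: svalP.
    case: pselect => [Dx|nx]; case: pselect => [Dy|ny].
    - by move=> /finj[].
    - by move=> /finj[] // _ /i_inj.
    - by move=> /finj[] // _ /i_inj.
    - move=> /finj[] // e _.
      have /g_inj[//] : g (exist _ x nx) = g (exist _ y ny).
      by apply: eq_sig_hprop => //= ? ? ?; exact: Prop_irrelevance.
  exists (fun z => f (u z.1) (u z.2)) => -[x y] [x' y'] /= /finj[] //.
  by move=> /u_inj -> /u_inj ->.
pose h x : X := match pselect (D x) with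
  | left Dx => sval (g (exist _ x Dx)) | right _ => i 0%N end.
have hN x : D x -> ~ D (h x).
  by rewrite /h; case: pselect => // Dx _; exact: (svalP (g _)).
have h_inj x y : D x -> D y -> h x = h y -> x = y.
  rewrite /h; case: pselect => // Dx _; case: pselect => // Dy _ e.
  have /g_inj[//] : g (exist _ x Dx) = g (exist _ y Dy).
  by apply: eq_sig_hprop => //= ? ? ?; exact: Prop_irrelevance.
pose D' := D `|` h @` D.
have /choice[b bP] z : exists x, D' z ->
    D x /\ ((D z /\ x = z) \/ (~ D z /\ h x = z)).
  have [Dz|nz] := pselect (D z); first by exists z => _; split=> //; left.
  have [[x Dx hx]|nh] := pselect ((h @` D) z).
    by exists x => _; split=> //; right.
  by exists z => -[].
have bD z : D' z -> D (b z) by move=> /bP[].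
have b_inj z w : D' z -> D' w -> `[< D z >] = `[< D w >] -> b z = b w -> z = w.
  move=> /bP[_ bz] /bP[_ bw] e.
  case: bz bw => -[nz ez] [[nw ew]|[nw ew]] eb.
  - by rewrite -ez eb.
  - by case: nw; apply/asboolP; rewrite -e; apply/asboolP.
  - by case: nz; apply/asboolP; rewrite e; apply/asboolP.
  - by rewrite -ez -ew eb.
(* Off the square of [D], values go to the copy of [D] under [h]. Since [b] sends a point and its
   copy to the same element, the pickled booleans record on which side [z] and [w] lie. *)
pose f' z w := if `[< D z >] && `[< D w >] then f z w else
  h (f (f (b z) (b w)) (i (pickle (`[< D z >], `[< D w >])))).
have Dh z w n : D' z -> D' w -> D (f (f (b z) (b w)) (i n)).
  by move=> D'z D'w; apply: (Df) => //; apply: (Df); exact: bD.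
have ok' : ok (D', f').
  split=> [n|x y D'x D'y|x y x' y' D'x D'y D'x' D'y'] /=; first by left.
    rewrite /f'; case: ifP => [/andP[/asboolP Dx /asboolP Dy]|_].
      by left; apply: Df.
    by right; exists (f (f (b x) (b y)) (i (pickle (`[< D x >], `[< D y >]))));
      first exact: Dh.
  rewrite /f'; case: ifP => [/andP[/asboolP Dx /asboolP Dy]|_];
    case: ifP => [/andP[/asboolP Dx' /asboolP Dy']|_].
  - exact: finj.
  - by move=> e; case: (hN (f (f (b x') (b y'))
      (i (pickle (`[< D x' >], `[< D y' >])))));
      [exact: Dh|rewrite -e; exact: Df].
  - by move=> e; case: (hN (f (f (b x) (b y))
      (i (pickle (`[< D x >], `[< D y >])))));
      [exact: Dh|rewrite e; exact: Df].
  - move=> /h_inj H; have {H} := H (Dh _ _ _ D'x D'y) (Dh _ _ _ D'x' D'y').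
    move=> /finj[]; rewrite ?Di //; try by apply: Df; exact: bD.
    move=> /finj[]; try exact: bD.
    move=> ex ey /i_inj/(pcan_inj pickleK)[tx ty].
    by split; apply: b_inj.
have /Dmax : R (exist _ _ Dok) (exist _ _ ok').
  apply/asboolP; split=> /= [x Dx|x y Dx Dy]; first by left.
  by rewrite /f'; do 2!case: asboolP => //.
move=> /asboolP[/= /(_ (h (i 0%N))) H _]; exfalso.
by apply: (hN (i 0%N)) => //; apply: H; right; exists (i 0%N).
Qed.

Lemma embeds_prod (X Y Z : Type) :
  embeds nat Z -> embeds X Z -> embeds Y Z -> embeds (X * Y) Z.
Proof.
move=> /embeds_mul_self ZZ [f fi] [g gi]; apply: embeds_trans ZZ.
by exists (fun u => (f u.1, g u.2)) => -[x y] [x' y'] /= [/fi -> /gi ->].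
Qed.

Lemma embeds_sum (X Y Z : Type) :
  embeds nat Z -> embeds X Z -> embeds Y Z -> embeds (X + Y) Z.
Proof.
move=> /[dup] -[i ii] /embeds_mul_self ZZ [f fi] [g gi]; apply: embeds_trans ZZ.
exists (fun u => match u with
  | inl x => (i 0%N, f x) | inr y => (i 1%N, g y) end).
by move=> [x|y] [x'|y'] [] // => [/fi ->|/ii|/ii|/gi ->].
Qed.

Lemma embeds_seq (Y Z : Type) : embeds nat Z -> embeds Y Z -> embeds (seq Y) Z.
Proof.
move=> iZ [f fi]; have [g gi] := embeds_mul_self iZ; have [i _] := iZ.
pose code := foldr (fun y z => g (f y, z)) (i 0%N).
apply: (@embeds_trans _ (nat * Z)); last exact: embeds_prod (embeds_refl _).
exists (fun s => (size s, code s)); elim=> [|x s IH] [|y t] //= [e].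
move=> /gi[/fi -> c]; congr cons; apply: IH.
by rewrite e c.
Qed.

Lemma card_lt_le (X Y Z : Type) : embeds X Y -> card_lt Y Z -> card_lt X Z.
Proof.
rewrite /card_lt !card_leTP => XY [YZ nZY]; split; first exact: embeds_trans YZ.
by move=> /embeds_trans/(_ XY).
Qed.

Lemma card_lt_bound (X Y S : Type) : card_lt X S -> card_lt Y S ->
  exists Z, [/\ card_lt Z S, embeds X Z & embeds Y Z].
Proof.
move=> XS YS; have [XY|YX] := embeds_total X Y.
  by exists Y; split=> //; exact: embeds_refl.
by exists X; split=> //; exact: embeds_refl.
Qed.

Lemma card_lt_sum (N X Y S : Type) : embeds nat N -> card_lt N S ->
  card_lt X S -> card_lt Y S -> card_lt (X + Y) S.
Proof.
move=> iN NS XS YS; have [Z [ZS NZ XZ]] := card_lt_bound NS XS.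
have [U [US ZU YU]] := card_lt_bound ZS YS.
apply: card_lt_le US; apply: embeds_sum YU.
  exact: embeds_trans iN (embeds_trans NZ ZU).
exact: embeds_trans XZ ZU.
Qed.

(** Pigeonhole: were all fibres finite, numbering each of them would embed [K] in [Q * nat], hence
    in [Q]. *)
Lemma embeds_fibers (K Q : Type) (F : K -> Q) : embeds nat Q ->
  ~ embeds K Q -> exists (q : Q) (k : nat -> K),
    injective k /\ forall n, F (k n) = q.
Proof.
move=> iQ nKQ; apply: contrapT => H; apply: nKQ.
have /choice[g gP] q : exists g : K -> nat,
    {in [set k | F k = q] &, injective g}.
  apply/countable_injP/finite_set_countable; apply: contrapT => inf.
  have /card_leP[f] := (infiniteP _).1 inf; apply: H.
  pose i n : [set: nat] := exist _ n (mem_set Logic.I).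
  exists q, (fun n => val (f (i n))); split; last first.
    by move=> n; exact: (set_mem (valP (f (i n)))).
  move=> n m /val_inj /inj.
  by rewrite !inE => /(_ Logic.I Logic.I)/(congr1 val).
apply: (@embeds_trans _ (Q * nat)); last exact: embeds_prod (embeds_refl _) _.
exists (fun k => (F k, g (F k) k)) => k l [e]; rewrite e.
by apply: gP; rewrite inE.
Qed.

(** * Renaming and satisfaction *)

Section Renaming.
Variable L : language.

Fixpoint trename (V U : Type) (h : V -> U) (t : term L V) : term L U :=
  match t with
  | Var v => Var L (h v)
  | App f ts => App (f := f) (fun i => trename h (ts i))
  end.

Fixpoint frename (V : Type) (f : formula L V) {struct f} :
    forall U : Type, (V -> U) -> formula L U :=
  match f with
  | Bot => fun U h => Bot
  | Eq t u => fun U h => Eq (trename h t) (trename h u)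
  | Rel r ts => fun U h => Rel (r := r) (fun i => trename h (ts i))
  | Imp g k => fun U h => Imp (frename g h) (frename k h)
  | All g => fun U h => All (frename g (omap h))
  end.

Lemma trename_id (V : Type) (t : term L V) : trename id t = t.
Proof. by elim: t => //= f ts IH; congr App; apply: funext. Qed.

Lemma frename_id (V : Type) (f : formula L V) : frename f id = f.
Proof.
elim: f => //= [{}V t u|{}V r ts|{}V g IHg k IHk|{}V g IH].
- by rewrite !trename_id.
- by congr Rel; apply: funext => i; rewrite trename_id.
- by rewrite IHg IHk.
- congr All; rewrite -[RHS]IH; congr frename.
  by apply: funext; case.
Qed.

Lemma trename_comp (V U W : Type) (h : V -> U) (k : U -> W) (t : term L V) :
  trename k (trename h t) = trename (k \o h) t.
Proof. by elim: t => //= f ts IH; congr App; apply: funext. Qed.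

Lemma frename_comp (V U W : Type) (f : formula L V) (h : V -> U) (k : U -> W) :
  frename (frename f h) k = frename f (k \o h).
Proof.
elim: f U W h k => //= [{}V t u|{}V r ts|{}V g IHg g' IHg'|{}V g IH] U W h k.
- by rewrite !trename_comp.
- by congr Rel; apply: funext => i; rewrite trename_comp.
- by rewrite IHg IHg'.
- congr All; rewrite IH; congr frename.
  by apply: funext; case.
Qed.

(** Syntactic finiteness, the source of the compactness arguments below. Phrasing it through
    renamings spares a definition of free variables; [{classic V}] supplies the equality test. *)
Lemma trename_support (V : Type) (t : term L V) : exists s : seq {classic V},
  forall U (h h' : V -> U), {in s, h =1 h'} -> trename h t = trename h' t.
Proof.
elim: t => [v|f ts /choice[s sP]].
  by exists [:: v] => U h h' /= ->; rewrite ?mem_head.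
exists (flatten [seq s i | i <- enum 'I_(farity f)]) => U h h' e /=.
congr App; apply: funext => i; apply: sP => v vs; apply: e.
by apply/flatten_mapP; exists i; rewrite ?mem_enum.
Qed.

Lemma frename_support (V : Type) (f : formula L V) : exists s : seq {classic V},
  forall U (h h' : V -> U), {in s, h =1 h'} -> frename f h = frename f h'.
Proof.
elim: f => [{}V|{}V t u|{}V r ts|{}V g [s sP] g' [s' s'P]|{}V g [s sP]].
- by exists [::].
- have [s sP] := trename_support t; have [s' s'P] := trename_support u.
  exists (s ++ s') => U h h' e /=; rewrite (sP _ h h') ?(s'P _ h h') // => v vs.
    by apply: e; rewrite mem_cat vs orbT.
  by apply: e; rewrite mem_cat vs.
- have /choice[s sP] i := trename_support (ts i).
  exists (flatten [seq s i | i <- enum 'I_(rarity r)]) => U h h' e /=.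
  congr Rel; apply: funext => i; apply: sP => v vs; apply: e.
  by apply/flatten_mapP; exists i; rewrite ?mem_enum.
- exists (s ++ s') => U h h' e /=; rewrite (sP _ h h') ?(s'P _ h h') // => v vs.
    by apply: e; rewrite mem_cat vs orbT.
  by apply: e; rewrite mem_cat vs.
- exists (pmap (fun o : {classic (option V)} => o : option {classic V}) s).
  move=> U h h' e /=; congr All.
  apply: sP => -[v|] //= vs; congr Some; apply: e.
  by rewrite mem_pmap; apply/mapP; exists (Some v).
Qed.

(** The finitely many variables are numbered by their positions in a list, so formulas over any [V]
    are counted by formulas over [nat] together with lists. *)
Lemma frename_decode (V : Type) (f : formula L V) (v0 : V) :
  exists (g : formula L nat) (s : seq V), f = frename g (nth v0 s).
Proof.
have [s sP] := frename_support f.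
exists (frename f (fun v => index (v : {classic V}) s)), s.
rewrite frename_comp -[LHS]frename_id; apply: sP => v vs /=.
by rewrite (nth_index (v0 : {classic V})).
Qed.

Lemma embeds_formula (V Z : Type) (v0 : V) : embeds nat Z ->
  embeds V Z -> embeds (formula L nat) Z -> embeds (formula L V) Z.
Proof.
move=> iZ VZ LZ; apply: (@embeds_trans _ (formula L nat * seq V)).
  have /choice[k kP] (f : formula L V) :
    exists z : formula L nat * seq V, f = frename z.1 (nth v0 z.2).
    by have [g [s ->]] := frename_decode f v0; exists (g, s).
  by exists k => f f' e; rewrite (kP f) (kP f') e.
exact/embeds_prod/embeds_seq.
Qed.

Lemma embeds_nat_formula : embeds nat (formula L nat).
Proof. by exists (fun n => Eq (Var L n) (Var L n)) => n m []. Qed.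

Definition And (V : Type) (f g : formula L V) := Neg (Imp f (Neg g)).
Definition Iff (V : Type) (f g : formula L V) := And (Imp f g) (Imp g f).
Definition Ex (V : Type) (f : formula L (option V)) := Neg (All (Neg f)).

End Renaming.

Section Satisfaction.
Variables (L : language) (M : structure L).

Lemma eval_trename (V U : Type) (h : V -> U) (t : term L V) (e : U -> M) :
  eval e (trename h t) = eval (e \o h) t.
Proof. by elim: t => //= f ts IH; congr finterp; apply: funext. Qed.

Lemma sat_frename (V U : Type) (f : formula L V) (h : V -> U) (e : U -> M) :
  sat e (frename f h) <-> sat (e \o h) f.
Proof.
elim: f U h e => //= [{}V t u|{}V r ts|{}V g IHg g' IHg'|{}V g IH] U h e.
- by rewrite !eval_trename.
- rewrite (_ : (fun i => eval e (trename h (ts i))) =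
               fun i => eval (e \o h) (ts i)) //.
  by apply: funext => i; rewrite eval_trename.
- by rewrite IHg IHg'.
- have H x : (oapp e x \o omap h) = (fun v => oapp (e \o h) x v).
    by apply: funext; case.
  by split=> H1 x; move: (H1 x); rewrite IH H.
Qed.

Lemma sat_support (V : Type) (f : formula L V) : exists s : seq {classic V},
  forall e e' : V -> M, {in s, e =1 e'} -> (sat e f <-> sat e' f).
Proof.
have [s sP] := frename_support f; exists s => e e' /sP H.
by rewrite -[e]/(id \o e) -[e']/(id \o e') -!sat_frename H.
Qed.

Lemma sat_And (V : Type) (e : V -> M) (f g : formula L V) :
  sat e (And f g) <-> sat e f /\ sat e g.
Proof.
split=> /= [H|[sf sg]]; last by apply.
by split; apply: contrapT => nf; apply: H => ? ?; exact: nf.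
Qed.

Lemma sat_Iff (V : Type) (e : V -> M) (f g : formula L V) :
  sat e (Iff f g) <-> (sat e f <-> sat e g).
Proof. by rewrite sat_And. Qed.

Lemma sat_Ex (V : Type) (e : V -> M) (f : formula L (option V)) :
  sat e (Ex f) <-> exists x, sat (oapp e x) f.
Proof.
split=> /= [H|[x sx] /(_ x)//].
by apply: contrapT => nx; apply: H => x sx; apply: nx; exists x.
Qed.

Lemma sat_conj (V : Type) (s : seq (formula L V)) :
  exists g : formula L V, forall e : V -> M,
    sat e g <->
    forall f : {classic (formula L V)}, f \in (s : seq {classic _}) -> sat e f.
Proof.
elim: s => [|f s [g gP]]; first by exists (Neg Bot) => e; split=> // _ ?.
exists (And f g) => e; rewrite sat_And gP; split=> [[sf sg] k|H].
  by rewrite inE => /orP[/eqP ->|/sg].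
by split=> [|k ks]; apply: H; rewrite inE ?eqxx // ks orbT.
Qed.

Definition sumf (U F : Type) (e : U -> M) (e' : F -> M) (v : U + F) : M :=
  match v with inl u => e u | inr x => e' x end.

Lemma sat_exists_ord (m : nat) (U : Type) (f : formula L (U + 'I_m)) :
  exists g : formula L U, forall e : U -> M,
    sat e g <-> exists e', sat (sumf e e') f.
Proof.
elim: m U f => [|m IH] U f.
  have no_ord (i : 'I_0) : U by case: i.
  exists (frename f (fun v => match v with inl u => u | inr i => no_ord i end)).
  have ee' (e : U -> M) (e' : 'I_0 -> M) :
      e \o (fun v => match v with inl u => u | inr i => no_ord i end) = sumf e e'.
    by apply: funext => -[//|[]].
  move=> e; rewrite sat_frename; split=> [H|[e']]; last by rewrite (ee' _ e').
  by exists (fun i => e (no_ord i)); rewrite -ee'.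
(* [ord0] becomes the variable [None] bound by [Ex]; the other indices shift down by one. *)
pose h (v : U + 'I_m.+1) : option (U + 'I_m) := match v with
  | inl u => Some (inl u)
  | inr i => omap inr (unlift ord0 i)
  end.
have [g gP] := IH U (Ex (frename f h)); exists g => e; rewrite gP; split.
  move=> [e'] /sat_Ex[x]; rewrite sat_frename => H.
  exists (fun i => oapp e' x (unlift ord0 i)); congr (sat _ f): H.
  by apply: funext => -[//|i] /=; case: unliftP.
move=> [e' H]; exists (e' \o lift ord0); apply/sat_Ex; exists (e' ord0).
rewrite sat_frename; congr (sat _ f): H; apply: funext => -[//|i] /=.
by case: unliftP => [j ->|->].
Qed.

(** [F] may be infinite, but [f] mentions only finitely many of its elements, so a finite block of
    quantifiers suffices. *)
Lemma sat_exists (U F : Type) (f : formula L (U + F)) :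
  exists g : formula L U, forall e : U -> M,
    sat e g <-> exists e', sat (sumf e e') f.
Proof.
have [s sP] := sat_support f.
pose sF : seq {classic F} :=
  pmap (fun v : {classic (U + F)} => if v is inr x then Some x else None) s.
(* The successor gives [inord] a target even when [sF] is empty; variables outside [sF] land on the
   last index. *)
pose h (v : U + F) : U + 'I_(size sF).+1 :=
  match v with
  | inl u => inl u | inr x => inr (inord (index (x : {classic F}) sF)) end.
have [g gP] := sat_exists_ord (frename f h); exists g => e; rewrite gP.
split=> [[e']|[e' He']].
  rewrite sat_frename => H; exists (fun x => e' (inord (index (x : {classic F}) sF))).
  by congr (sat _ f): H; apply: funext => -[].
have [x0] := carrier_inhabited M.
have [[y0 _]|nF] := pselect (exists y : F, True).
  exists (fun i => e' (nth (y0 : {classic F}) sF i)); rewrite sat_frename.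
  apply/(sP _ (sumf e e')) => // -[//|y] ys /=; rewrite inordK ?ltnS ?index_size //.
  rewrite nth_index // mem_pmap; apply/mapP; by exists (inr y).
exists (fun=> x0); rewrite sat_frename; congr (sat _ f): He'.
by apply: funext => -[//|y]; case: nF; exists y.
Qed.

Lemma automorphism_eval (s : M -> M) (V : Type) (e : V -> M) (t : term L V) :
  is_automorphism s -> eval (s \o e) t = s (eval e t).
Proof.
move=> [_ sf _]; elim: t => //= f ts IH.
by rewrite sf; congr finterp; apply: funext.
Qed.

Lemma automorphism_sat (s : M -> M) (V : Type) (f : formula L V) (e : V -> M) :
  is_automorphism s -> (sat (s \o e) f <-> sat e f).
Proof.
move=> as_; have [[s' sK s'K] _ sr] := as_.
elim: f e => //= [{}V t u|{}V r ts|{}V g IHg k IHk|{}V g IH] e.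
- by rewrite !automorphism_eval //; split=> [/(can_inj sK)|->].
- rewrite (_ : (fun i => _) = (fun i => s (eval e (ts i)))) -?sr //.
  by apply: funext => i; rewrite automorphism_eval.
- by rewrite IHg IHk.
- have H x : (fun v => oapp (s \o e) (s x) v) = s \o (fun v => oapp e x v).
    by apply: funext; case.
  split=> H1 x; first by have := H1 (s x); rewrite H IH.
  by rewrite -[x]s'K H IH.
Qed.

End Satisfaction.

(** * Realising types in many variables *)

Lemma finite_set_seq (T : Type) (A : set T) : finite_set A ->
  exists s : seq {classic T}, forall x : T, A x <-> (x : {classic T}) \in s.
Proof. by move=> /(@finite_seqP {classic T})[s ->]; exists s. Qed.

Section Realize.
Variables (L : language) (M : structure L) (S N : Type).
Hypotheses (nat_N : embeds nat N) (N_lt : card_lt N S)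
  (M_sat : is_saturated M S).

Section Extension.
Variables (V : Type) (A : set M) (q : set (formula L (V + A))).
Hypotheses (V_lt : card_lt V S) (A_lt : card_lt A S).

(** The invariant for Zorn's lemma: with the values on [D] frozen, [q] stays finitely
    satisfiable. *)
Definition partial_solution (D : set V) (e : V -> M) : Prop :=
  forall s : seq (formula L (V + A)),
    (forall f : {classic _}, f \in (s : seq {classic _}) -> q f) ->
  exists2 e', forall v, D v -> e' v = e v
    & forall f : {classic _}, f \in (s : seq {classic _}) -> sat (env e') f.

Lemma extend_solution (D : set V) (e : V -> M) (v : V) :
  partial_solution D e -> ~ D v ->
  exists x, partial_solution (D `|` [set v])
                (fun w => if `[< w = v >] then x else e w).
Proof.
move=> De nDv; pose B := A `|` e @` D.
have B_lt : card_lt B S.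
  apply: card_lt_le (card_lt_sum nat_N N_lt A_lt V_lt).
  have /choice[k kP] (b : B) : exists z : A + V,
      match z with inl a => val a = val b | inr w => e w = val b end.
    have := set_mem (valP b) => -[Ab|[w _ ew]].
      by exists (inl (exist _ (val b) (mem_set Ab))).
    by exists (inr w).
  exists k => b b' e'; apply: val_inj; have := kP b; have := kP b'.
  by rewrite e'; case: (k b') => ? -> ->.
have AB (a : A) : (val a) \in B by rewrite inE; left; exact: (set_mem (valP a)).
have DB w : D w -> e w \in B by move=> Dw; rewrite inE; right; exists w.
(* [h] sorts the variables: [v] becomes the variable of the one-variable type, those in [D] become
   parameters, and the rest are to be quantified out. *)
pose h (z : V + A) : (unit + B) + V := match z with
  | inr a => inl (inr (exist _ (val a) (AB a)))
  | inl w => if pselect (w = v) is left _ then inl (inl tt) else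
      match pselect (D w) with
      | left Dw => inl (inr (exist _ (e w) (DB w Dw)))
      | right _ => inr w
      end
  end.
have hE (x : unit -> M) (e' : V -> M) : sumf (env x) e' \o h =
    env (fun w => if `[< w = v >] then x tt else
                  if `[< D w >] then e w else e' w).
  apply: funext => -[w|a] //=.
  case: pselect => /= [->|nw]; first by case: asboolP.
  case: asboolP => // _.
  by case: pselect => /= Dw; case: asboolP.
have /choice[cj cjP] := sat_conj M (V := V + A).
have /choice[ex exP] := sat_exists M (U := unit + B) (F := V).
pose g s := ex (frename (cj s) h).
have gP s (x : unit -> M) : sat (env x) (g s) <-> exists e' : V -> M,
    forall f : {classic _}, f \in (s : seq {classic _}) ->
    sat (env (fun w => if `[< w = v >] then x tt else
                  if `[< D w >] then e w else e' w)) f.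
  rewrite /g exP; split=> -[e']; first by rewrite sat_frename cjP hE; exists e'.
  by move=> H; exists e'; rewrite sat_frename cjP hE.
pose r : set (formula L (unit + B)) := [set k | exists2 s,
   (forall f : {classic _}, f \in (s : seq {classic _}) -> q f) & k = g s].
have [r0 r0r /finite_set_seq[s0 s0P]|x xr] := M_sat B_lt (q := r).
  have /choice[t tP] (k : formula L (unit + B)) : exists s, r0 k ->
     (forall f : {classic _}, f \in (s : seq {classic _}) -> q f) /\ k = g s.
    have [/r0r[s sq ->]|nk] := pselect (r0 k); first by exists s.
    by exists [::].
  (* Finitely many formulas [g s] are handled at once by concatenating the lists behind them. *)
  pose ts : seq {classic _} :=
    flatten [seq (t k : seq {classic _}) | k : {classic _} <- s0].
  have [f|e' e'D e'q] := De ts.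
    rewrite /ts => /flatten_mapP[k ks0]; have [+ _] := tP _ ((s0P k).2 ks0).
    exact.
  exists (fun=> e' v) => k r0k; have [tq ->] := tP _ r0k.
  apply/gP; exists e' => f fk.
  rewrite (_ : (fun w => _) = e').
    by apply: e'q; apply/flatten_mapP; exists k => //; apply/s0P.
  apply: funext => w; case: asboolP => [-> //|_].
  by case: asboolP => // /e'D.
exists (x tt) => s sq.
have /gP[e' He'] : sat (env x) (g s) by apply: xr; exists s.
eexists; last exact: He'.
move=> w Dw /=; case: asboolP => // nw.
by case: Dw => [Dw|//]; case: asboolP.
Qed.

(** A maximal partial solution is defined everywhere by [extend_solution]. Chains have upper bounds
    because a finite list of formulas involves finitely many variables, and those in the union of
    the domains are all settled in one member of the chain. *)
Lemma realize_partial_type : is_partial_type q -> exists e, realizes q e.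
Proof.
move=> q_fin; have [m0] := carrier_inhabited M.
pose ok (t : set V * (V -> M)) := partial_solution t.1 t.2.
have ok0 : ok (set0, fun=> m0).
  move=> s sq; have [k /= ks||e eP] :=
    q_fin [set f | (f : {classic _}) \in (s : seq {classic _})].
  - exact: sq.
  - by apply/(@finite_seqP {classic _}); exists s.
  - by exists e.
pose R (t u : {t | ok t}) := `[< (sval t).1 `<=` (sval u).1 /\
   forall v, (sval t).1 v -> (sval u).2 v = (sval t).2 v >].
have [|r s t /asboolP[rs ers] /asboolP[st est]|F Ftot|] :=
  @ZL_preorder _ (exist _ _ ok0) R.
- by move=> t; apply/asboolP; split.
- apply/asboolP; split=> [x /rs/st //|x rx].
  by rewrite est ?ers //; apply: rs.
- have [[t0 Ft0]|nF] := pselect (exists t, F t); last first.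
    by exists (exist _ _ ok0) => s Fs; case: nF; exists s.
  pose D := [set v | exists2 t, F t & (sval t).1 v].
  have /choice[e eP] (v : V) : exists x, forall t, F t -> (sval t).1 v ->
      x = (sval t).2 v.
    have [[t Ft tv]|nv] := pselect (D v); last first.
      by exists m0 => t Ft tv; case: nv; exists t.
    exists ((sval t).2 v) => u Fu uv.
    by have [/asboolP[_ ->]|/asboolP[_ ->]] := Ftot _ _ Ft Fu.
  have dir (s : seq {classic V}) :
      exists2 t, F t & forall v : {classic V}, v \in s -> D v -> (sval t).1 v.
    elim: s => [|v s [t Ft IH]]; first by exists t0.
    have [[u Fu uv]|nv] := pselect (D v); last first.
      by exists t => // w; rewrite inE => /orP[/eqP ->|/IH].
    have [/asboolP[tu _]|/asboolP[ut _]] := Ftot _ _ Ft Fu.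
      exists u => // w; rewrite inE => /orP[/eqP -> //|ws Dw].
      by apply: tu; apply: IH.
    by exists t => // w; rewrite inE => /orP[/eqP -> _|/IH //]; apply: ut.
  have okD : ok (D, e).
    move=> s sq.
    have [cs csP] : exists cs : seq {classic V}, forall e1 e2 : V -> M,
        {in cs, e1 =1 e2} ->
        (forall f : {classic _}, f \in (s : seq {classic _}) -> sat (env e1) f) ->
        (forall f : {classic _}, f \in (s : seq {classic _}) -> sat (env e2) f).
      have /choice[sp spP] := sat_support M (V := V + A).
      pose k (f : formula L (V + A)) : seq {classic V} :=
        pmap (fun z : {classic (V + A)} =>
          if z is inl v then Some (v : {classic V}) else None) (sp f).
      exists (flatten [seq k f | f : {classic _} <- s]) => e1 e2 e12 H f fs.
      apply/(spP f (env e1)); last exact: H.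
      move=> -[v|//] vf /=; apply: e12; apply/flatten_mapP; exists f => //.
      by rewrite mem_pmap; apply/mapP; exists (inl v).
    have [t Ft tP] := dir cs.
    have [e' e't e'q] := svalP t s sq.
    exists (fun v => if `[< D v >] then e v else e' v) => /= [v Dv|].
      by case: asboolP.
    apply: csP e'q => v vcs; case: asboolP => // Dv.
    by rewrite e't ?(eP _ t) //; apply: tP.
  exists (exist _ _ okD) => t Ft; apply/asboolP; split=> [v tv|v tv] /=.
    by exists t.
  exact: eP.
move=> [[D e] Dok] Dmax; have De : partial_solution D e := Dok.
have Dfull v : D v.
  apply: contrapT => nv; have [x xok] := extend_solution De nv.
  have /Dmax : R (exist _ _ Dok) (exist (fun t => ok t) (D `|` [set v], _) xok).
    apply/asboolP; split=> /= [w Dw|w Dw]; first by left.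
    by case: asboolP => // ewv; case: nv; rewrite -ewv.
  by move=> /asboolP[/(_ v)/= H _]; apply: nv; apply: H; right.
exists e => f qf; have [|e' e'e e'f] := De [:: f].
  by move=> g; rewrite inE => /eqP ->.
have -> : e = e' by apply: funext => v; rewrite e'e.
by apply: e'f; rewrite inE.
Qed.

End Extension.
End Realize.

(** * Ramsey's theorem *)

(** Sets of size [n] are encoded as increasing lists, two-coloured by the truth of [P]. *)
Definition homogeneous (n : nat) (P : seq nat -> Prop) (h : nat -> nat) : Prop :=
  forall s t, sorted ltn s -> sorted ltn t -> size s = n -> size t = n ->
    (P (map h s) <-> P (map h t)).

Lemma increasing_enumeration (Q : nat -> Prop) :
  (forall m, exists2 k, (m <= k)%N & Q k) ->
  exists2 h : nat -> nat, {homo h : i j / (i < j)%N} & forall i, Q (h i).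
Proof.
move=> ex; have /choice[nx nxP] m : exists k, (m <= k)%N /\ Q k.
  by have [k mk Qk] := ex m; exists k.
pose h := fix h i := if i is j.+1 then nx (h j).+1 else nx 0%N.
exists h; last by case=> [|i]; exact: (nxP _).2.
by apply: homo_ltn => [? ? ?|i]; [exact: ltn_trans|exact: (nxP _).1].
Qed.

Lemma sorted_ltn_map (h : nat -> nat) (s : seq nat) :
  {homo h : i j / (i < j)%N} -> sorted ltn s -> sorted ltn (map h s).
Proof. by move=> hh; apply: homo_sorted. Qed.

(** Induction on [n]. Along the diagonal sequence [X] the colour of an increasing list depends on
    its first term only; a last pigeonhole makes that dependence constant. *)
Lemma ramsey (n : nat) (P : seq nat -> Prop) :
  exists2 h : nat -> nat, {homo h : i j / (i < j)%N} & homogeneous n P h.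
Proof.
elim: n P => [|n IH] P.
  by exists id => // s t _ _ /size0nil -> /size0nil ->.
have /choice[G GP] (h : nat -> nat) : exists g,
    {homo g : i j / (i < j)%N} /\
    homogeneous n (fun s => P (h 0%N :: map (h \o S) s)) g.
  by have [g gi gh] := IH (fun s => P (h 0%N :: map (h \o S) s)); exists g.
(* [H i.+1] drops the first term of [H i] and thins out the rest, so that all increasing lists of
   the given size starting with that term get one colour. *)
pose H := fix H i : nat -> nat := if i is j.+1 then H j \o S \o G (H j) else id.
have H_incr i : {homo H i : j k / (j < k)%N}.
  elim: i => //= i IHi j k jk; apply: IHi; rewrite ltnS.
  by have [+ _] := GP (H i); apply.
pose X i := H i 0%N.
have X_incr : {homo X : i j / (i < j)%N}.
  apply: homo_ltn => [? ? ?|i]; first exact: ltn_trans.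
  exact: H_incr.
have XH i j : (i <= j)%N -> exists m, X j = H i m.
  suff : (i <= j)%N -> exists f, H j = H i \o f.
    by move=> H1 /H1[f Hf]; exists (f 0%N); rewrite /X Hf.
  move=> /subnK <-; elim: (j - i)%N => [|k [f IHf]]; first by exists id.
  by exists (f \o S \o G (H (k + i)%N)); rewrite addSn /= {1}IHf.
have HomX i s t : sorted ltn s -> sorted ltn t -> size s = n -> size t = n ->
    all (ltn i) s -> all (ltn i) t ->
    (P (X i :: map X s) <-> P (X i :: map X t)).
  have /choice[f fP] j : exists m, (i < j)%N -> X j = H i.+1 m.
    have [/XH[m Hm]|_] := ltnP i j; first by exists m.
    by exists 0%N.
  have f_incr : {in ltn i &, {homo f : j k / (j < k)%N}}.
    move=> j k ij ik jk; rewrite ltnNge; apply/negP => fkj.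
    have := X_incr _ _ jk; rewrite ltnNge (fP _ ij) (fP _ ik) => /negP; apply.
    exact: (ltnW_homo (H_incr i.+1)).
  have E u : all (ltn i) u ->
      X i :: map X u = H i 0%N :: map (H i \o S) (map (G (H i)) (map f u)).
    move=> iu; congr cons; rewrite -!map_comp; apply/eq_in_map => j /(allP iu).
    exact: fP.
  move=> ss st zs zt is' it; rewrite !E //.
  have [_ +] := GP (H i); apply; rewrite ?size_map //;
    by apply: (homo_sorted_in f_incr).
(* The colour forced by the first term [X i], read off on the next [n] terms. *)
pose col i := P (X i :: map X (iota i.+1 n)).
have colP i s : path ltn i s -> size s = n -> P (X i :: map X s) <-> col i.
  move=> si zs; have iota_all : all (ltn i) (iota i.+1 n).
    by apply/allP => j; rewrite mem_iota => /andP[].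
  apply: HomX => //; rewrite ?size_iota //.
  - exact: path_sorted si.
  - exact: iota_ltn_sorted.
  - exact: (order_path_min ltn_trans si).
have [h h_incr hcol] : exists2 h, {homo h : i j / (i < j)%N} &
    forall i j, col (h i) <-> col (h j).
  have [inf|fin] := pselect (forall m, exists2 k, (m <= k)%N & col k).
    by have [h hi hc] := increasing_enumeration inf; exists h => // i j; split.
  move/existsNP: fin => [m nm].
  have [m'|h hi hc] := @increasing_enumeration (fun k => ~ col k).
    exists (m + m')%N; first exact: leq_addl.
    by move=> cm; apply: nm; exists (m + m')%N; first exact: leq_addr.
  by exists h => // i j; split=> /hc.
exists (X \o h) => [i j ij|]; first by apply: X_incr; apply: h_incr.
have E i s : path ltn i s -> size s = n -> P (map (X \o h) (i :: s)) <-> col (h i).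
  move=> si zs; rewrite map_comp /=; apply: colP; last by rewrite size_map.
  by have := sorted_ltn_map (s := i :: s) h_incr si.
move=> [|i s] [|j t] //= si tj [zs] [zt]; have := E _ _ si zs; have := E _ _ tj zt.
by move=> /= -> ->; exact: hcol.
Qed.

Lemma ramsey_list (Ps : seq (nat * (seq nat -> Prop))) :
  exists2 h : nat -> nat, {homo h : i j / (i < j)%N} &
    forall P : {classic _}, P \in (Ps : seq {classic _}) -> homogeneous P.1 P.2 h.
Proof.
elim: Ps => [|[n P] Ps [h hi hP]]; first by exists id.
have [g gi gP] := ramsey n (fun s => P (map h s)).
exists (h \o g) => [i j ij|Q]; first by apply: hi; apply: gi.
rewrite inE => /orP[/eqP -> s t ss st zs zt|/hP H s t ss st zs zt].
  by rewrite !(map_comp h g); apply: gP.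
rewrite !(map_comp h g); apply: H; rewrite ?size_map //; exact: sorted_ltn_map.
Qed.

(** * Initial ordinals *)

Section InitialOrdinal.
Variables (d : Order.disp_t) (W : orderType d).
Hypotheses (W_ord : is_initial_ordinal W) (W_inf : embeds nat W).

Lemma initial_ordinal_min (Q : set W) : Q !=set0 ->
  exists2 m, Q m & forall x, Q x -> (m <= x)%O.
Proof.
move=> [x Qx]; have [|m [[Qm mmin] _]] := W_ord.1 (fun x => `[< Q x >]).
  by exists x; apply/asboolP.
by exists m => [|y Qy]; [exact/asboolP|apply: mmin; exact/asboolP].
Qed.

Lemma initial_ordinal_wf : well_founded (fun x y : W => (x < y)%O).
Proof.
move=> x; apply: contrapT => nx.
have [|m nm mmin] := @initial_ordinal_min
  [set x | ~ Acc (fun x y : W => (x < y)%O) x]; first by exists x.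
apply: nm; split=> y ym; apply: contrapT => /mmin.
by rewrite leNgt ym.
Qed.

(** A bound [b] would put [W] into the segment up to [b]. An infinite [W] has room to spare, so the
    value [b] can be avoided, and then [W] embeds strictly below [b], against initiality. *)
Lemma initial_ordinal_unbounded (f : W -> W) (b : W) : injective f ->
  exists i, (b < f i)%O.
Proof.
move=> f_inj; apply: contrapT => bd.
have fb i : (f i <= b)%O by rewrite leNgt; apply/negP => bfi; apply: bd; exists i.
have unitW : embeds unit W by have [u _] := W_inf; exists (fun=> u 0%N) => -[] [].
have [g g_inj] := embeds_sum W_inf (embeds_refl W) unitW.
(* The value [f (g (inr tt))] is kept free and replaces [b] where [b] would be taken. *)
pose k w := if f (g (inl w)) == b then f (g (inr tt)) else f (g (inl w)).
have kb w : k w != b.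
  rewrite /k; case: ifPn => // /eqP <-; apply/eqP.
  by move=> /f_inj/g_inj.
have k_inj : injective k.
  move=> w w'; rewrite /k; case: ifPn => [/eqP e|_]; case: ifPn => [/eqP e'|_].
  - by move=> _; have := etrans e (esym e') => /f_inj/g_inj[].
  - by move=> /f_inj/g_inj.
  - by move=> /f_inj/g_inj.
  - by move=> /f_inj/g_inj[].
apply: (W_ord.2 b).
have /inj_card_eq : {in [set: W] &, injective k} by move=> x y _ _; apply: k_inj.
rewrite card_eq_le => /andP[_ /card_le_trans]; apply; apply: subset_card_le.
move=> _ [w _ <-] /=; rewrite lt_neqAle kb /k /=.
by case: ifP => _; exact: fb.
Qed.

(** [W] contains two disjoint copies of itself, and each of them is unbounded. *)
Lemma initial_ordinal_split : exists E : set W, forall alpha,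
  (exists2 i, (alpha < i)%O & E i) /\ (exists2 i, (alpha < i)%O & ~ E i).
Proof.
have [g g_inj] := embeds_sum W_inf (embeds_refl W) (embeds_refl W).
exists (range (g \o inl)) => alpha; split.
  have [|i ai] := @initial_ordinal_unbounded (g \o inl) alpha.
    by move=> x y /g_inj[].
  by exists (g (inl i)) => //; exists i.
have [|i ai] := @initial_ordinal_unbounded (g \o inr) alpha.
  by move=> x y /g_inj[].
by exists (g (inr i)) => // -[x _ /g_inj].
Qed.

(** Otherwise [W] would be covered by the segment up to [alpha] and the image of the segment below
    [i], two sets no larger than one bounded segment: [W] would be finite or would embed in a
    bounded set. *)
Lemma initial_ordinal_tail_not_covered (f : W -> W) (alpha i : W) :
  exists2 j, (alpha < j)%O & forall i', (i' < i)%O -> f i' <> j.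
Proof.
apply: contrapT => H.
have cov j : (alpha < j)%O -> exists2 i', (i' < i)%O & f i' = j.
  move=> aj; apply: contrapT => nj; apply: H; exists j => // i' i'i e.
  by apply: nj; exists i'.
pose b := Order.max alpha i.
have ab j : (j <= alpha)%O -> (j <= b)%O by move=> ja; rewrite le_max ja.
have ib j : (j < i)%O -> (j <= b)%O by move=> /ltW ji; rewrite le_max ji orbT.
have [fin|inf] := pselect (finite_set [set j | (j <= b)%O]).
  have : finite_set ([set j | (j <= b)%O] `|` f @` [set j | (j <= b)%O]).
    by rewrite finite_setU; split=> //; exact: finite_image.
  rewrite (_ : _ `|` _ = setT); last first.
    apply/seteqP; split=> // j _; have [/ab|/cov[i' /ib i'b <-]] := leP j alpha.
      by left.
    by right; exists i'.
  by apply/infiniteP/card_leTP.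
pose Z := {j : W | (j <= b)%O}.
have natZ : embeds nat Z.
  have /card_leP[g] := (infiniteP _).1 inf.
  pose u n : [set: nat] := exist _ n (mem_set Logic.I).
  have gb n : (val (g (u n)) <= b)%O := set_mem (valP (g (u n))).
  exists (fun n => exist (fun j => (j <= b)%O : Prop) _ (gb n) : Z) => n m [/val_inj /inj].
  by rewrite !inE => /(_ Logic.I Logic.I)/(congr1 val).
have [g g_inj] := embeds_sum natZ (embeds_refl Z) (embeds_refl Z).
have /choice[k kP] (j : W) : exists z : Z + Z, match z with
    inl x => val x = j | inr x => f (val x) = j end.
  have [/ab jb|/cov[i' /ib i'b <-]] := leP j alpha.
    by exists (inl (exist _ j jb)).
  by exists (inr (exist _ i' i'b)).
have [|j] := @initial_ordinal_unbounded (fun j => val (g (k j))) b.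
  move=> x y /val_inj/g_inj e; have := kP x; have := kP y; rewrite e.
  by case: (k y) => z -> ->.
by rewrite ltNge (valP (g (k j))).
Qed.

(* A tail of an initial ordinal is isomorphic to the whole: [f i] is the least
   element of the tail which is not yet the image of some [i' < i]. *)
Lemma initial_ordinal_tail (alpha : W) : exists f : W -> W,
  [/\ {homo f : i j / (i < j)%O}, forall i, (alpha < f i)%O
    & forall j, (alpha < j)%O -> exists i, f i = j].
Proof.
pose rest (i : W) (g : forall i' : W, (i' < i)%O -> W) : set W :=
  [set j | (alpha < j)%O /\ forall i' (p : (i' < i)%O), g i' p <> j].
pose F i g := xget alpha [set m | rest i g m /\ forall x, rest i g x -> (m <= x)%O].
pose f := Fix initial_ordinal_wf (fun=> W) F.
have fE i : f i = F i (fun i' _ => f i').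
  rewrite /f Fix_eq // => x g h gh; congr (F x).
  by do 2!apply: functional_extensionality_dep => ?.
have fP i : rest i (fun i' _ => f i') (f i) /\
    forall x, rest i (fun i' _ => f i') x -> (f i <= x)%O.
  have [|m mr mmin] := @initial_ordinal_min (rest i (fun i' _ => f i')).
    have [j aj fj] := initial_ordinal_tail_not_covered f alpha i.
    by exists j; split.
  rewrite fE /F; case: xgetP => [y _ //|/(_ m)[]//].
have f_incr : {homo f : i j / (i < j)%O}.
  move=> i j ij; have [[af nf] _] := fP j; have [_ fmin] := fP i.
  rewrite lt_neqAle; apply/andP; split; first by apply/eqP; exact: nf.
  by apply: fmin; split=> // i' i'i; apply: nf; exact: lt_trans ij.
have f_ge i : (i <= f i)%O.
  elim/(well_founded_ind initial_ordinal_wf): i => i IH.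
  rewrite leNgt; apply/negP => fi; have := f_incr _ _ fi.
  by rewrite ltNge IH.
exists f; split=> // [i|j aj]; first by have [[]] := fP i.
(* A missed [j] is still available at stage [j], so [f j] is at most [j]; as [f] dominates the
   identity, [j] is attained after all. *)
apply: contrapT => nj; have [_ /(_ j)] := fP j; have fj : (f j <= j)%O.
  by have [_ +] := fP j; apply; split=> // i' _ e; apply: nj; exists i'.
by move=> _; apply: nj; exists j; apply/le_anti; rewrite fj f_ge.
Qed.

End InitialOrdinal.

(** * Indiscernible sequences *)

Section Indiscernible.
Variables (L : language) (M : structure L).

Lemma same_type_sub (V : Type) (B B' : set M) (e e' : V -> M) :
  B' `<=` B -> same_type B e e' -> same_type B' e e'.
Proof.
move=> sub H f.
have inB (b : B') : val b \in B by apply/mem_set/sub/set_mem/valP.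
pose h (z : V + B') : V + B :=
  match z with inl v => inl v | inr b => inr (exist _ (val b) (inB b)) end.
have hE (k : V -> M) : env k \o h = env k by apply: funext => -[].
by have := H (frename f h); rewrite !sat_frename !hE.
Qed.

Lemma same_type_comp (V U : Type) (B : set M) (e e' : V -> M) (k : U -> V) :
  same_type B e e' -> same_type B (e \o k) (e' \o k).
Proof.
move=> H f.
pose h (z : U + B) : V + B := match z with inl v => inl (k v) | inr b => inr b end.
have hE (e1 : V -> M) : env e1 \o h = env (e1 \o k) by apply: funext => -[].
by have := H (frename f h); rewrite !sat_frename !hE.
Qed.

Variables (d : Order.disp_t) (W : orderType d) (X : Type).

Lemma indiscernible_sub (D D' : set W) (B B' : set M) (a : W -> X -> M) :
  D' `<=` D -> B' `<=` B -> indiscernible D B a -> indiscernible D' B' a.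
Proof.
move=> sD sB H n s t Ds Dt si ti; apply: same_type_sub sB _.
by apply: H => // k; apply: sD.
Qed.

Lemma indiscernible_image (f : W -> W) (D : set W) (B : set M) (a : W -> X -> M) :
  {homo f : i j / (i < j)%O} ->
  indiscernible D B (a \o f) -> indiscernible (f @` D) B a.
Proof.
move=> fi H n s t Ds Dt si ti.
have pre (u : 'I_n -> W) : (forall k, (f @` D) (u k)) ->
    {homo u : k l / (k < l)%N >-> (k < l)%O} -> exists u' : 'I_n -> W,
    [/\ forall k, D (u' k), forall k, f (u' k) = u k
      & {homo u' : k l / (k < l)%N >-> (k < l)%O}].
  move=> Du ui; have /choice[u' u'P] k : exists i, D i /\ f i = u k.
    by have [i] := Du k; exists i.
  exists u'; split=> [k|k|k l kl]; [exact: (u'P k).1|exact: (u'P k).2|].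
  have := ui _ _ kl; rewrite -(u'P k).2 -(u'P l).2 !ltNge.
  by apply: contra; exact: ltW_homo.
have [s' [Ds' fs' s'i]] := pre s Ds si; have [t' [Dt' ft' t'i]] := pre t Dt ti.
have <- : (fun v : 'I_n * X => (a \o f) (s' v.1) v.2) = (fun v => a (s v.1) v.2).
  by apply: funext => v /=; rewrite fs'.
have <- : (fun v : 'I_n * X => (a \o f) (t' v.1) v.2) = (fun v => a (t v.1) v.2).
  by apply: funext => v /=; rewrite ft'.
exact: H.
Qed.

Lemma indiscernible_preimage (f : W -> W) (D : set W) (B : set M)
    (a : W -> X -> M) :
  {homo f : i j / (i < j)%O} ->
  indiscernible D B a -> indiscernible (f @^-1` D) B (a \o f).
Proof.
move=> fi H n s t Ds Dt si ti.
by apply: (H n (f \o s) (f \o t)) => // k l kl; apply: fi; [apply: si|apply: ti].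
Qed.

(* Adding one parameter at a time needs the tail to be indexed by [W] again. *)
Lemma indiscernible_tail_seq (W_ord : is_initial_ordinal W)
    (W_inf : embeds nat W) (A : set M) (p : set (formula L (X + A))) :
  (forall A' : set M, A `<=` A' -> finite_set (A' `\` A) ->
     forall a : W -> X -> M, (forall i, realizes p (a i)) ->
     indiscernible setT A' a ->
     forall c : M, exists alpha : W,
       indiscernible [set i | (alpha < i)%O] (A' `|` [set c]) a) ->
  forall (cs : seq {classic M}) (A' : set M), A `<=` A' -> finite_set (A' `\` A) ->
     forall a : W -> X -> M, (forall i, realizes p (a i)) ->
     indiscernible setT A' a ->
     exists alpha : W, indiscernible [set i | (alpha < i)%O]
       (A' `|` [set c | (c : {classic M}) \in cs]) a.
Proof.
move=> tailH; elim=> [|c cs IH] A' AA' fA' a pa ia.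
  have [u _] := W_inf; exists (u 0%N).
  by apply: indiscernible_sub ia => // x [].
have [alpha ia'] := tailH A' AA' fA' a pa ia c.
have [f [fi fa fs]] := initial_ordinal_tail W_ord W_inf alpha.
have [||i|//|beta ib] := IH (A' `|` [set c]) _ _ (a \o f).
- by move=> x Ax; left; exact: AA'.
- apply: (@sub_finite_set _ _ ((A' `\` A) `|` [set c])).
    by move=> x [[A'x|->] nAx]; [left|right].
  by rewrite finite_setU; split=> //; exact: finite_set1.
- exact: pa.
- by apply: indiscernible_sub (indiscernible_preimage fi ia') => // i _; exact: fa.
(* The image under [f] of the tail above [beta] covers the tail above [f beta]. *)
exists (f beta); apply: indiscernible_sub (indiscernible_image fi ib).
  move=> j bj /=; have [|i fij] := fs j; first exact: lt_trans bj.
  exists i => //=; rewrite ltNge; apply/negP => ib'.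
  by move: bj; rewrite /= -fij ltNge (ltW_homo fi).
move=> x [A'x|/=]; first by left; left.
by rewrite inE => /orP[/eqP ->|xs]; [left; right|right].
Qed.

End Indiscernible.

(** * Shattering and alternation *)

(** This makes the rank of an element among finitely many listed ones strictly increasing. *)
Lemma count_ltn_sub (T : eqType) (a b : pred T) (s : seq T) (x : T) :
  subpred a b -> x \in s -> b x -> ~~ a x -> (count a s < count b s)%N.
Proof.
move=> ab + bx nax; elim: s => //= z s IH; rewrite inE => /orP[/eqP <-|/IH lt].
  by rewrite bx (negPf nax) ltnS sub_count.
by rewrite -addnS leq_add //; case az: (a z) => //; rewrite ab.
Qed.

Section Shattering.
Variables (L : language) (M : structure L) (S N : Type).
Hypotheses (nat_N : embeds nat N) (N_lt : card_lt N S).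
Variables (A : set M) (X : Type) (p : set (formula L (X + A))).
Hypothesis A_lt : card_lt A S.
(** The tuple side of [phi] is indexed by [nat], as only finitely many coordinates matter. Sequences
    of tuples of different lengths can thus share one formula. *)
Variable phi : formula L (nat + (A + X)).

Local Notation holds y c := (sat (sumf y (sumf val c)) phi).

Section Pattern.
Hypothesis M_hom : is_strongly_homogeneous M S.
Variables (c : X -> M) (y : nat -> bool -> nat -> M).
Hypothesis c_p : realizes p c.
Hypothesis y_flip : forall l,
  same_type (A `|` \bigcup_(k in [set k | k <> l]) \bigcup_b range (y k b))
    (y l true) (y l false).
Hypothesis y_phi : forall l b, holds (y l b) c <-> b.

Let choose (eta : nat -> bool) (z : nat * nat) : M := y z.1 (eta z.1) z.2.

(** Once the tuples of index other than [l] are read as parameters, only [y l] varies, and [y_flip]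
    applies. *)
Lemma choose_flip1 (l : nat) (eta eta' : nat -> bool) (f : formula L (nat * nat + A)) :
  (forall k, k <> l -> eta k = eta' k) ->
  sat (env (choose eta)) f <-> sat (env (choose eta')) f.
Proof.
move=> ee'; set B := A `|` \bigcup_(k in [set k | k <> l]) \bigcup_b range (y k b).
have AB (a : A) : val a \in B by rewrite inE; left; exact: (set_mem (valP a)).
have yB z : z.1 <> l -> choose eta z \in B.
  move=> nz; rewrite inE; right; exists z.1 => //.
  by exists (eta z.1) => //; exists z.2.
pose h (v : nat * nat + A) : nat + B := match v with
  | inl z => match pselect (z.1 <> l) with
     | left nz => inr (exist _ (choose eta z) (yB z nz)) | right _ => inl z.2 end
  | inr a => inr (exist _ (val a) (AB a))
  end.
have hE eta1 : (forall k, k <> l -> eta k = eta1 k) ->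
    env (y l (eta1 l)) \o h = env (choose eta1).
  move=> ee1; apply: funext => -[z|//] /=.
  case: pselect => /= [nz|]; first by rewrite /choose ee1.
  by move=> /contrapT e; rewrite /choose e.
rewrite -(hE eta) // -(hE eta') // -!sat_frename.
by have := @y_flip l (frename f h); case: (eta l); case: (eta' l) => // ->.
Qed.

(** A formula mentions finitely many tuples, which are switched one after another along [mix]. *)
Lemma choose_same_type (eta eta' : nat -> bool) :
  same_type A (choose eta) (choose eta').
Proof.
move=> f; have [s sP] := sat_support M f.
have [m sm] : exists m, forall z,
    (inl z : {classic (nat * nat + A)}) \in s -> (z.1 < m)%N.
  elim: s {sP} => [|v s [m IH]]; first by exists 0%N.
  exists (maxn m (if v is inl z then z.1.+1 else 0)) => z.
  by rewrite inE leq_max => /orP[/eqP <-|/IH ->//]; rewrite leqnn orbT.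
pose mix k l := if (l < k)%N then eta' l else eta l.
have mixP k : sat (env (choose eta)) f <-> sat (env (choose (mix k))) f.
  elim: k => [|k ->]; first by [].
  apply: (@choose_flip1 k) => l lk; rewrite /mix ltnS [(l <= k)%N]leq_eqVlt.
  by case: eqP.
rewrite (mixP m); apply: sP => -[z|//] zs.
by rewrite /= /choose /mix sm.
Qed.

(** By homogeneity an automorphism over [A] carries the pattern chosen by [eta] to the all-true one;
    the image of [c] is the required realisation. *)
Lemma shattered (eta : nat -> bool) :
  exists2 c', realizes p c' & forall l, holds (y l true) c' <-> eta l.
Proof.
pose e1 := env (choose eta) : nat * nat + A -> M.
pose e2 := env (choose xpredT) : nat * nat + A -> M.
have V_lt : card_lt (nat * nat + A) S.
  apply: (card_lt_sum nat_N N_lt _ A_lt); apply: card_lt_le N_lt.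
  exact: embeds_prod.
(* Homogeneity is stated without parameters, so the elements of [A] are made part of the tuples; the
   automorphism then fixes them. *)
have [f|s s_auto se] := M_hom V_lt (e := e1) (e' := e2).
  pose h (v : (nat * nat + A) + (set0 : set M)) : nat * nat + A := match v with
    | inl z => z | inr a => False_rect _ (set_mem (valP a)) end.
  have hE (e : nat * nat + A -> M) : env e = e \o h.
    by apply: funext => -[z //|a]; case: (set_mem (valP a)).
  rewrite !hE -!sat_frename; exact: choose_same_type.
have sA (a : A) : s (val a) = val a := se (inr a).
exists (s \o c) => [f pf|l].
  rewrite (_ : env (s \o c) = s \o env c).
    by rewrite automorphism_sat //; exact: c_p.
  by apply: funext => -[//|a] /=; rewrite sA.
rewrite (_ : sumf _ _ = s \o sumf (y l (eta l)) (sumf val c)).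
  by rewrite automorphism_sat.
apply: funext => -[v|[a|//]] /=; last by rewrite sA.
exact: (esym (se (inl (l, v)))).
Qed.

(* [c' i] is chosen so that [phi(y l true, c' i)] holds exactly when [i] is in
   the [l]-th finite set of naturals. *)
Lemma dual_shattered : exists c' : nat -> X -> M, (forall i, realizes p (c' i)) /\
  forall (E : set nat) (s : seq nat), exists y' : nat -> M,
    forall i, i \in s -> (holds y' (c' i) <-> E i).
Proof.
pose eta i l := i \in odflt [::] (unpickle l : option (seq nat)).
have /choice[c' c'P] i : exists c', realizes p c' /\
    forall l, holds (y l true) c' <-> eta i l.
  by have [c' c'p c'e] := shattered (eta i); exists c'.
exists c'; split=> [i|E s]; first exact: (c'P i).1.
exists (y (pickle [seq i <- s | `[< E i >]]) true) => i is_.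
rewrite (c'P i).2 /eta pickleK /= mem_filter is_ andbT.
by split=> /asboolP.
Qed.

End Pattern.

Section Alternation.
Hypotheses (M_sat : is_saturated M S) (X_lt : card_lt X S).
Variables (d : Order.disp_t) (W : orderType d).
Hypothesis W_lt : card_lt W S.
Variable c : nat -> X -> M.
Hypothesis c_p : forall i, realizes p (c i).
Hypothesis c_shatter : forall (E : set nat) (s : seq nat), exists y : nat -> M,
    forall i, i \in s -> (holds y (c i) <-> E i).
Variable E : set W.

(** A variable [(i, x)] stands for coordinate [x] of the sought [a i], and the variables in [nat]
    stand for [y]. *)
Let V : Type := W * X + nat.

Let at_index (i : W) (v : X + A) : V + A :=
  match v with inl x => inl (inl (i, x)) | inr a => inr a end.
Let at_indices (n : nat) (s : 'I_n -> W) (v : 'I_n * X + A) : V + A :=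
  match v with inl z => inl (inl (s z.1, z.2)) | inr a => inr a end.
Let at_phi (i : W) (v : nat + (A + X)) : V + A :=
  match v with
  | inl m => inl (inr m) | inr (inl a) => inr a | inr (inr x) => inl (inl (i, x))
  end.

Let type_p : set (formula L (V + A)) :=
  [set f | exists i g, p g /\ f = frename g (at_index i)].
Let type_indisc : set (formula L (V + A)) :=
  [set f | exists n (s t : 'I_n -> W) (g : formula L ('I_n * X + A)),
     [/\ {homo s : k l / (k < l)%N >-> (k < l)%O},
         {homo t : k l / (k < l)%N >-> (k < l)%O}
       & f = Iff (frename g (at_indices s)) (frename g (at_indices t))]].
Let type_phi : set (formula L (V + A)) :=
  [set f | exists i, (E i /\ f = frename phi (at_phi i)) \/
                     (~ E i /\ f = Neg (frename phi (at_phi i)))].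
Let type_all := type_p `|` type_indisc `|` type_phi.

Let sat_at_index (e : V -> M) i g :
  sat (env e) (frename g (at_index i)) <-> sat (env (fun x => e (inl (i, x)))) g.
Proof.
rewrite sat_frename (_ : _ \o _ = env (fun x => e (inl (i, x)))) //.
by apply: funext => -[].
Qed.

Let sat_at_indices (e : V -> M) n (s : 'I_n -> W) g :
  sat (env e) (frename g (at_indices s)) <->
  sat (env (fun z : 'I_n * X => e (inl (s z.1, z.2)))) g.
Proof.
rewrite sat_frename (_ : _ \o _ = env (fun z : 'I_n * X => e (inl (s z.1, z.2)))) //.
by apply: funext => -[].
Qed.

Let sat_at_phi (e : V -> M) i :
  sat (env e) (frename phi (at_phi i)) <->
  holds (fun m => e (inr m)) (fun x => e (inl (i, x))).
Proof.
rewrite sat_frename.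
rewrite (_ : _ \o _ = sumf (fun m => e (inr m)) (sumf val (fun x => e (inl (i, x))))) //.
by apply: funext => -[//|[]].
Qed.

Let increasing_on (ws : seq W) (r : W -> nat) : Prop :=
  {in ws &, {homo r : i j / (i < j)%O >-> (i < j)%N}}.

(* [f] holds as soon as the variables are interpreted along the subsequence
   [h \o r] of [c], provided that [r], [h] and [y] behave well on the finite
   data [ws] and [Ps]. *)
Let controlled (f : formula L (V + A)) (ws : seq W)
    (Ps : seq (nat * (seq nat -> Prop))) : Prop :=
  forall (r : W -> nat) (h : nat -> nat) (y : nat -> M),
    increasing_on ws r ->
    (forall P : {classic _}, P \in (Ps : seq {classic _}) -> homogeneous P.1 P.2 h) ->
    (forall i, i \in ws -> (holds y (c (h (r i))) <-> E i)) ->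
  sat (env (sumf (fun z : W * X => c (h (r z.1)) z.2) y)) f.

Let sorted_enum_map n (s : 'I_n -> W) (r : W -> nat) :
  increasing_on [seq s k | k <- enum 'I_n] r ->
  {homo s : k l / (k < l)%N >-> (k < l)%O} ->
  sorted ltn [seq r (s k) | k <- enum 'I_n].
Proof.
move=> ri si; apply: (@homo_sorted _ _ _ (relpre val ltn)); last first.
  by rewrite -sorted_map val_enum_ord iota_ltn_sorted.
by move=> k l kl; apply: ri; [apply: map_f| apply: map_f|apply: si];
  rewrite ?mem_enum.
Qed.

Let type_all_controlled f : type_all f -> exists ws Ps, controlled f ws Ps.
Proof.
move=> [[[i [g [pg ->]]]|[n [s [t [g [si ti ->]]]]]]|[i Ei]].
- exists [::], [::] => r h y _ _ _; rewrite sat_at_index.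
  by have H := @c_p (h (r i)) g pg; exact: H.
- exists ([seq s k | k <- enum 'I_n] ++ [seq t k | k <- enum 'I_n]).
  (* Lists of naturals are coloured by the truth of [g] along [c]. Both index tuples become
     increasing lists under [r], so homogeneity gives them one colour. *)
  exists [:: (n, fun m => sat (env (fun z : 'I_n * X => c (nth 0%N m z.1) z.2)) g)].
  move=> r h y ri hh _; rewrite sat_Iff !sat_at_indices /=.
  have {hh} := hh _ (mem_head _ _) [seq r (s k) | k <- enum 'I_n]
                 [seq r (t k) | k <- enum 'I_n].
  have sz (u : 'I_n -> W) : size [seq r (u k) | k <- enum 'I_n] = n.
    by rewrite size_map size_enum_ord.
  move=> /= /(_ _ _ (sz s) (sz t)) hh.
  have hE (u : 'I_n -> W) :
      (fun z : 'I_n * X => c (nth 0%N (map h [seq r (u k) | k <- enum 'I_n]) z.1) z.2)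
      = (fun z => c (h (r (u z.1))) z.2).
    apply: funext => -[k x] /=; rewrite -map_comp (nth_map k) ?size_enum_ord //=.
    by rewrite nth_ord_enum.
  rewrite !hE in hh; apply: hh; apply: sorted_enum_map => // i j iu ju;
    by apply: ri; rewrite mem_cat ?iu ?ju ?orbT.
- exists [:: i], [::] => r h y _ _ /(_ i (mem_head _ _)) yE.
  by case: Ei => -[Ei ->]; [|move]; rewrite /= sat_at_phi /= yE.
Qed.

(** Compactness: a finite part of [type_all] involves finitely many indices and colourings. Ramsey's
    theorem supplies [h], the rank among these indices supplies [r], and shattering on the resulting
    finite set of naturals supplies [y]. *)
Lemma alternating_sequence : exists (a : W -> X -> M) (y : nat -> M),
  [/\ forall i, realizes p (a i), indiscernible setT A a
    & forall i, holds y (a i) <-> E i].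
Proof.
have V_lt : card_lt V S.
  apply: (card_lt_sum nat_N N_lt); last exact: card_lt_le N_lt.
  have [Z [Z_lt NZ XZ]] := card_lt_bound N_lt X_lt.
  have [Z' [Z'_lt ZZ' WZ']] := card_lt_bound Z_lt W_lt.
  apply: card_lt_le Z'_lt; apply: embeds_prod => //.
    exact: embeds_trans nat_N (embeds_trans NZ ZZ').
  exact: embeds_trans XZ ZZ'.
have [|e eP] := realize_partial_type nat_N N_lt M_sat V_lt A_lt (q := type_all).
  move=> q0 q0q /finite_set_seq[s0 s0P].
  have /choice[ws wsP] f : exists ws, type_all f -> exists Ps, controlled f ws Ps.
    have [/type_all_controlled[ws [Ps H]]|nf] := pselect (type_all f);
      last by exists [::].
    by exists ws => _; exists Ps.
  have /choice[Ps PsP] f : exists Ps, type_all f -> controlled f (ws f) Ps.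
    have [/wsP[Ps H]|nf] := pselect (type_all f); last by exists [::].
    by exists Ps.
  pose ws0 := flatten [seq ws f | f : {classic _} <- s0].
  pose Ps0 : seq {classic _} :=
    flatten [seq (Ps f : seq {classic _}) | f : {classic _} <- s0].
  have [h hi hh] := ramsey_list Ps0.
  pose r (w : W) := count (fun w' => w' < w)%O ws0.
  have ri : increasing_on ws0 r.
    move=> i j is_ js ij; rewrite /r.
    apply: (count_ltn_sub (x := i)) => //; last by rewrite ltxx.
    by move=> w /lt_trans; exact.
  (* This is [E] carried over to the naturals, faithfully because [h] is injective and [r] is
     injective on [ws0]. *)
  pose E' m := exists2 w, w \in ws0 & E w /\ m = h (r w).
  have [y yP] := c_shatter E' [seq h (r w) | w <- ws0].
  have h_inj : injective h := incn_inj (leq_mono hi).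
  have r_inj : {in ws0 &, injective r}.
    move=> i j is_ js e; case: (ltgtP i j) => // ij.
      by have := ri _ _ is_ js ij; rewrite e ltnn.
    by have := ri _ _ js is_ ij; rewrite e ltnn.
  exists (sumf (fun z : W * X => c (h (r z.1)) z.2) y) => f q0f.
  have fs0 := (s0P f).1 q0f.
  apply: (PsP f (q0q _ q0f)) => [i j is_ js|P Pf|i is_].
  - by apply: ri; apply/flatten_mapP; exists f.
  - by apply: hh; apply/flatten_mapP; exists f.
  - have i0 : i \in ws0 by apply/flatten_mapP; exists f.
    rewrite yP; last exact: map_f.
    split=> [[w w0 [Ew /h_inj/r_inj -> //]]|Ei].
    by exists i.
exists (fun i x => e (inl (i, x))), (fun m => e (inr m)).
split=> [i g pg|n s t _ _ si ti g|i].
- by apply/sat_at_index; apply: eP; left; left; exists i, g.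
- have /sat_Iff : sat (env e)
      (Iff (frename g (at_indices s)) (frename g (at_indices t))).
    by apply: eP; left; right; exists n, s, t, g.
  by rewrite !sat_at_indices.
- have [Ei|nEi] := pselect (E i).
    split=> // _; apply/sat_at_phi; apply: eP; right; exists i; by left.
  split=> // Hi; exfalso.
  have : sat (env e) (Neg (frename phi (at_phi i))).
    by apply: eP; right; exists i; right.
  by apply; apply/sat_at_phi.
Qed.

End Alternation.
End Shattering.

(** * Formulas witnessing a failure of indiscernibility *)

Section Witness.
Variables (L : language) (M : structure L).

(** Failure of indiscernibility is a formula true at one increasing tuple and false at another. Its
    parameters from [c] turn into variables and its finitely many tuple coordinates are numbered;
    indiscernibility over [B] still gives both tuples the same type. *)
Lemma not_indiscernible_witness (d : Order.disp_t) (I : orderType d) (J X : Type)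
    (A B : set M) (c : X -> M) (a : I -> J -> M) :
  indiscernible setT B a -> ~ indiscernible setT (A `|` range c) a ->
  exists (phi : formula L (nat + (A + X))) (y : bool -> nat -> M),
    [/\ forall b, sat (sumf (y b) (sumf val c)) phi <-> b,
        same_type B (y true) (y false)
      & forall b v, exists i, range (a i) (y b v)].
Proof.
move=> aB na.
have [n [s [t [si ti [f [sf nf]]]]]] : exists n (s t : 'I_n -> I),
    [/\ {homo s : k l / (k < l)%N >-> (k < l)%O},
        {homo t : k l / (k < l)%N >-> (k < l)%O}
      & exists f : formula L ('I_n * J + (A `|` range c)),
          sat (env (fun v => a (s v.1) v.2)) f /\
          ~ sat (env (fun v => a (t v.1) v.2)) f].
  apply: contrapT => H; apply: na => n s t _ _ si ti f; split=> sf;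
    apply: contrapT => nf; apply: H.
    by exists n, s, t; split=> //; exists f.
  by exists n, t, s; split=> //; exists f.
pose u (b : bool) := if b then s else t.
pose e b (v : 'I_n * J) := a (u b v.1) v.2.
have fb b : sat (env (e b)) f <-> b by case: b.
(* Without coordinates the two tuples would coincide; [v0] serves as the default of [nth]. *)
have [v0] : inhabited ('I_n * J).
  apply: contrapT => H; apply: nf; congr (sat _ f): sf; apply: funext => -[v|//].
  by case: H.
have /choice[k kP] (z : (A `|` range c : set M)) : exists w : A + X,
    sumf val c w = val z.
  have [Az|[x _ cx]] := set_mem (valP z); last by exists (inr x).
  by exists (inl (exist _ (val z) (mem_set Az))).
pose h0 (z : 'I_n * J + (A `|` range c : set M)) : 'I_n * J + (A + X) :=
  match z with inl v => inl v | inr w => inr (k w) end.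
have [sp spP] := sat_support M (frename f h0).
pose sU : seq {classic ('I_n * J)} := pmap (fun z : {classic ('I_n * J + (A + X))} =>
  if z is inl v then Some (v : {classic _}) else None) sp.
pose h1 (z : 'I_n * J + (A + X)) : nat + (A + X) :=
  match z with inl v => inl (index (v : {classic _}) sU) | inr w => inr w end.
exists (frename (frename f h0) h1), (fun b => e b \o nth v0 sU); split=> [b|f'|b v].
- rewrite sat_frename (spP _ (sumf (e b) (sumf val c))); last first.
    move=> -[v|//] vs /=; rewrite (nth_index (v0 : {classic _})) //.
    by rewrite mem_pmap; apply/mapP; exists (inl v).
  rewrite sat_frename -fb (_ : _ \o _ = env (e b)) //.
  by apply: funext => -[//|w] /=.
- by apply: same_type_comp; apply: aB.
- by exists (u b (nth v0 sU v).1); exists (nth v0 sU v).2.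
Qed.

End Witness.

Theorem theorem2p9
  (L : language) (T : set (sentence L)) (hT : is_complete T)
  (S : Type) (C : structure L) (hC : is_monster_model T S C)
  (A : set C) (hA : card_lt A S)
  (X : Type) (hX : card_lt X S)
  (p : set (formula L (X + A))) (hp : is_partial_type p)
  (* KT = |T|^+, KA = |A|^+, and W is the initial ordinal |T|^+ + |A|^+ *)
  (KT : Type) (hKT : is_succ_card KT (card_theory L))
  (KA : Type) (hKA : is_succ_card KA A)
  (d : Order.disp_t) (W : orderType d) (hW : is_initial_ordinal W)
  (hcardW : [set: W] #= [set: (KT + KA)%type])
  (h : forall A' : set C, A `<=` A' -> finite_set (A' `\` A) ->
       forall a : W -> X -> C, (forall i, realizes p (a i)) ->
       indiscernible setT A' a ->
       forall c : C, exists alpha : W,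
         indiscernible [set i | (alpha < i)%O] (A' `|` [set c]) a) :
  dependent S p.
Proof.
have [_ S_lim T_lt C_sat C_hom] := hC.
have nat_T := embeds_nat_formula L; rewrite -/(card_theory L) in nat_T.
(* As [S] is a limit, some small cardinal lies above [Y], and it bounds the successor of [Y]. *)
have succ_lt (K Y : Type) : is_succ_card K Y -> card_lt Y S -> card_lt K S.
  move=> [_ Kmin] /S_lim[Z YZ ZS]; apply: card_lt_le ZS.
  by apply/card_leTP; exact: Kmin.
move: hcardW; rewrite card_eq_le => /andP[/card_leTP W_le /card_leTP W_ge].
have W_lt : card_lt W S.
  apply: card_lt_le W_le _; apply: (card_lt_sum nat_T T_lt).
    exact: succ_lt hKT T_lt.
  exact: succ_lt hKA hA.
have nat_W : embeds nat W.
  apply: embeds_trans nat_T _; have [[/card_leTP TK _] _] := hKT.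
  apply: embeds_trans TK (embeds_trans _ W_ge).
  by exists inl => x y [].
pose Q := formula L (nat + (A + X)).
have nat_Q : embeds nat Q.
  by exists (fun n => Eq (Var L (inl n)) (Var L (inl n))) => n m [].
have Q_lt : card_lt Q S.
  have V_lt : card_lt (nat + (A + X)) S.
    apply: (card_lt_sum nat_T T_lt (card_lt_le nat_T T_lt)).
    exact: (card_lt_sum nat_T T_lt).
  have [Z [Z_lt TZ VZ]] := card_lt_bound T_lt V_lt.
  apply: card_lt_le Z_lt; apply: (embeds_formula (inl 0%N) _ VZ TZ).
  exact: embeds_trans nat_T TZ.
(* [K] is small yet exceeds the number of possible witnessing formulas. *)
have [K [_ nKQ] K_lt] := S_lim _ Q_lt.
exists K => // c c_p dI I J a _ _ a_mut.
apply: contrapT => nK.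
pose B k := A `|` \bigcup_(l in [set l | l <> k]) \bigcup_i range (a l i).
have /choice[w wP] (k : K) : exists w : Q * (bool -> nat -> C),
    [/\ forall b, sat (sumf (w.2 b) (sumf val c)) w.1 <-> b,
        same_type (B k) (w.2 true) (w.2 false)
      & forall b v, exists i, range (a k i) (w.2 b v)].
  have [|phi [y yP]] :=
    not_indiscernible_witness (X := X) (A := A) (c := c) (a_mut k).
    by move=> ik; apply: nK; exists k.
  by exists (phi, y).
have [phi [k [k_inj k_phi]]] : exists (phi : Q) (k : nat -> K),
    injective k /\ forall n, (w (k n)).1 = phi.
  by apply: (embeds_fibers (fun k => (w k).1) nat_Q); rewrite -card_leTP.
(* The witnessing tuples of the sequences [k l] form the pattern. Entries of the tuples at other
   indices come from other sequences, hence lie in [B (k l)]. *)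
have [l|l b|c' [c'_p c'_shatter]] := dual_shattered nat_T T_lt hA (phi := phi)
    C_hom c_p (y := fun l => (w (k l)).2).
- have [_ + _] := wP (k l); apply: same_type_sub => x [Ax|]; first by left.
  move=> [m ml [b _ [v _ <-]]]; right; exists (k m).
    by move=> /k_inj.
  by have [_ _ /(_ b v)[i ?]] := wP (k m); exists i.
- by rewrite -(k_phi l); have [+ _ _] := wP (k l); apply.
have [E EP] := initial_ordinal_split hW nat_W.
have [s [y [s_p s_ind s_phi]]] :=
  alternating_sequence nat_T T_lt hA C_sat hX W_lt c'_p c'_shatter E.
have [sp spP] := sat_support C phi.
(* Indices that [phi] does not mention are redirected to 0, leaving finitely many parameters; this
   is why [y 0] heads [cs]. *)
pose pick (v : nat) := if (inl v : {classic (nat + (A + X))}) \in sp then v else 0%N.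
pose cs : seq {classic C} := y 0%N :: pmap (fun z : {classic (nat + (A + X))} =>
  if z is inl v then Some (y v : {classic C}) else None) sp.
have [||alpha alphaP] :=
  indiscernible_tail_seq hW nat_W h cs (A' := A) _ _ s_p s_ind.
- by [].
- by rewrite setDv.
have [[i ai Ei] [j aj nEj]] := EP alpha.
set D := A `|` _ in alphaP.
have AD (z : A) : val z \in D by rewrite inE; left; exact: (set_mem (valP z)).
have yD v : y (pick v) \in D.
  rewrite inE; right => /=; rewrite /cs inE /pick.
  case: ifP => vs; last by rewrite eqxx.
  by apply/orP; right; rewrite mem_pmap; apply/mapP; exists (inl v).
(* Along [g], [phi] becomes a formula over [D] about a single term of the sequence. *)
pose g (z : nat + (A + X)) : 'I_1 * X + D := match z with
  | inl v => inr (exist _ (y (pick v)) (yD v))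
  | inr (inl z) => inr (exist _ (val z) (AD z))
  | inr (inr x) => inl (ord0, x)
  end.
have gE l : sat (env (fun v : 'I_1 * X => s l v.2)) (frename phi g) <-> E l.
  rewrite sat_frename -s_phi; apply: spP => -[v|[z|x]] zs //=.
  by rewrite /pick zs.
have one_incr (l : W) : {homo (fun _ : 'I_1 => l) : k l / (k < l)%N >-> (k < l)%O}.
  by move=> u v; rewrite (ord1 u) (ord1 v).
(* Indiscernibility for single terms equates the truth values at [i] and [j], both above [alpha],
   although [E] separates them. *)
have := alphaP 1%N (fun=> i) (fun=> j) (fun=> ai) (fun=> aj)
  (one_incr i) (one_incr j).
by move=> /(_ (frename phi g)); rewrite !gE => -[/(_ Ei)].
Qed.
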